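(* Let $\phi$ be a CLTLB($\mathcal{D}$) formula and let $\rho=\alpha\beta^\omega\in SV(\phi)^\omega$ be an ultimately periodic word with $\alpha=\alpha's$ and $\beta=\beta's$ (for some $s\in SV(\phi)$), and let $k=|\alpha\beta|-1$. Then there is a non-strict (resp. strict) infinite backward path in $\rho$ if, and only if, there are two points $p,p'$ of $\rho$ such that $\mathit{sv}(p)=|\alpha'|$, $\mathit{sv}(p')=k$, $p\equiv p'$, and $p\stackrel{\succcurlyeq}{\frown}p'$ (resp. $p\stackrel{\succ}{\frown}p'$).
   Context: $\mathcal{D}$ is a constraint system over a domain $D$ with a strict total order $<$ and equality among its relations (e.g. $(D,<,=)$ or $\mathrm{IPC}^*$ over $\mathbb{Z}$); $V$ is a finite set of variables. A.t.t.'s: $\alpha::=c\mid x\mid\mathrm{X}\alpha\mid\mathrm{Y}\alpha$, depth $|c|=|x|=0$, $|\mathrm{X}\alpha|=|\alpha|+1$, $|\mathrm{Y}\alpha|=|\alpha|-1$. CLTLB($\mathcal{D}$) formulae are built from atomic relations $R(\alpha_1,\dots,\alpha_n)$ over a.t.t.'s with $\wedge,\neg,\mathbf{X},\mathbf{Y},\mathbf{U},\mathbf{S}$. $\lceil\phi\rceil$ / $\lfloor\phi\rfloor$: max / min of $0$ and depths of a.t.t.'s of $\phi$; $\lambda=\lceil\phi\rceil-\lfloor\phi\rfloor+1$. $\mathit{terms}(\phi)$: $\mathrm{X}^ix$ ($0\le i\le\lceil\phi\rceil$), $\mathrm{Y}^ix$ ($1\le i\le-\lfloor\phi\rfloor$),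 $x\in V$; $\mathit{const}(\phi)$: constants of $\phi$ (for discrete $D$, all values between the least and greatest). A symbolic valuation is a consistent (terms treated as distinct fresh variables) and maximal set of $\mathcal{D}$-constraints over $\mathit{terms}(\phi)\cup\mathit{const}(\phi)$; $SV(\phi)$ is their set; $sv\models_{sym}\xi$ iff every assignment satisfying $sv$ satisfies $\xi$. Graph: vertices are pairs $(x,a)$, $x\in V\cup\mathit{const}(\phi)$, $a$ an absolute position; there is an edge from $(x,a)$ to $(y,b)$ labeled $\sim\in\{<,=\}$ iff there is $l\ge0$ with $a-l,b-l\in[\lfloor\phi\rfloor,\lceil\phi\rceil]$ and $(\mathrm{X}^{a-l}x\sim\mathrm{X}^{b-l}y)\in\rho(l)$ ($\mathrm{X}^{-n}$ meaning $\mathrm{Y}^n$). An infinite forward (resp. backward) path is a sequence $d:\mathbb{N}\to$ vertices such that for all $i$ there is an edge from $d(i)$ to $d(i+1)$ (resp. from $d(i+1)$ to $d(i)$) and the position of $d(i)$ is $\le$ that of $d(i+1)$; it is strict if infinitely many of these edges are labeled $<$. Points: a point is $p=(x,j,h)$ with $x\in V\cup\mathit{const}(\phi)$, $j\ge0$, $h\in[\lfloor\phi\rfloor,\lceil\phi\rceil]$, $\mathit{var}(p)=x$, $\mathit{sv}(p)=j$, $\mathit{shift}(p)=h$, representing vertex $(x,j+h)$. For $p_1=(x,j,h)$, $p_2=(y,i,m)$: $p_1\preccurlyeq p_2$ iff (1) $i+m-(j+h)<\lambda$, (2) $j+h\le i+m$, (3) for a position $l\ge0$ with $j+h-l,i+m-l\in[\lfloor\phi\rfloor,\lceil\phi\rceil]$,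 $\rho(l)\models_{sym}\mathrm{X}^{j+h-l}x\le\mathrm{X}^{i+m-l}y$. $\prec,\approx,\succcurlyeq,\succ$: same with $\le$ replaced by $<,=,\ge,>$. $\stackrel{\preccurlyeq}{\frown},\stackrel{\approx}{\frown},\stackrel{\succcurlyeq}{\frown}$ are the transitive closures of $\preccurlyeq,\approx,\succcurlyeq$; $p_1\stackrel{\prec}{\frown}p_2$ iff $p_1\stackrel{\preccurlyeq}{\frown}p'\prec p''\stackrel{\preccurlyeq}{\frown}p_2$ for some $p',p''$; $p_1\stackrel{\succ}{\frown}p_2$ iff $p_1\stackrel{\succcurlyeq}{\frown}p'\succ p''\stackrel{\succcurlyeq}{\frown}p_2$ for some $p',p''$. $p\equiv p'$ iff same variable, same shift, and $\mathit{sv}(p')=\mathit{sv}(p)+i|\beta|$ for some $i\in\mathbb{Z}$.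
   Formalization: Two departures: ρ is assumed locally consistent (adjacent symbolic valuations agree on shared terms), and in the non-strict case the infinite backward path must reach ever larger positions, since self-loops labelled = otherwise give trivial infinite paths; without these the claim is false. *)

(* Defs.v *)
From Stdlib Require Relation_Operators.
From mathcomp Require Import all_boot all_order all_algebra.

Set Implicit Arguments.
Unset Strict Implicit.
Unset Printing Implicit Defensive.

Import Order.TTheory GRing.Theory Num.Theory.
Local Open Scope ring_scope.

(* [csrel n] is the type of names of n-ary relations; the strict order and the
   equality of D are among the binary ones, and other relations are arbitrary. *)
Record constraint_system (disp : Order.disp_t) (D : orderType disp) := ConstraintSystem {
  csrel : nat -> Type;
  csint : forall n : nat, csrel n -> n.-tuple D -> Prop;
  cslt : csrel 2;
  cseq : csrel 2;
  csltP : forall a b : D, csint cslt [tuple a; b] <-> (a < b)%O;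
  cseqP : forall a b : D, csint cseq [tuple a; b] <-> a = b
}.

(* Discreteness in the sense of N and Z: order intervals are finite. *)
Definition discrete_order (disp : Order.disp_t) (D : orderType disp) : Prop :=
  forall a b : D, exists s : seq D,
    forall c : D, (a <= c)%O -> (c <= b)%O -> c \in s.

Section Syntax.

Variables (disp : Order.disp_t) (D : orderType disp) (CS : constraint_system D).
Variable V : finType.

Inductive att : Type :=
  | Cst of D
  | Var of V
  | Nxt of att
  | Prv of att.

Fixpoint depth (t : att) : int :=
  match t with
  | Cst _ => 0
  | Var _ => 0
  | Nxt t' => depth t' + 1
  | Prv t' => depth t' - 1
  end.

Fixpoint att_consts (t : att) : seq D :=
  match t with
  | Cst c => [:: c]
  | Var _ => [::]
  | Nxt t' => att_consts t'
  | Prv t' => att_consts t'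
  end.

Inductive atom : Type := Atom (n : nat) (R : csrel CS n) (ts : n.-tuple att).

Definition atom_args (a : atom) : seq att := let: Atom _ _ ts := a in ts.

Inductive formula : Type :=
  | FAtom of atom
  | FAnd of formula & formula
  | FNot of formula
  | FNext of formula
  | FPrev of formula
  | FUntil of formula & formula
  | FSince of formula & formula.

Fixpoint atts (phi : formula) : seq att :=
  match phi with
  | FAtom a => atom_args a
  | FNot f | FNext f | FPrev f => atts f
  | FAnd f g | FUntil f g | FSince f g => atts f ++ atts g
  end.

Definition fceil (phi : formula) : int :=
  \big[Order.max/0]_(t <- atts phi) depth t.

Definition ffloor (phi : formula) : int :=
  \big[Order.min/0]_(t <- atts phi) depth t.

Definition flambda (phi : formula) : int := fceil phi - ffloor phi + 1.

Definition in_window (phi : formula) (h : int) : Prop :=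
  (ffloor phi <= h <= fceil phi)%R.

Definition occ_consts (phi : formula) : seq D := flatten (map att_consts (atts phi)).

Definition in_const (phi : formula) (c : D) : Prop :=
  c \in occ_consts phi \/
  (discrete_order D /\
   exists c1 c2 : D, [/\ c1 \in occ_consts phi, c2 \in occ_consts phi,
                         (c1 <= c)%O & (c <= c2)%O]).

(* A symbol is a variable or a constant. *)
Definition in_symb (phi : formula) (u : V + D) : Prop :=
  match u with inl _ => True | inr c => in_const phi c end.

(* X^h u, where X^(-n) is Y^n.  A shifted constant is the constant itself, since
   the only terms over constants in a symbolic valuation are bare constants. *)
Definition xterm (u : V + D) (h : int) : att :=
  match u, h with
  | inl x, Posz n => iter n Nxt (Var x)
  | inl x, Negz n => iter n.+1 Prv (Var x)
  | inr c, _ => Cst c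
  end.

(* terms(phi) together with const(phi) *)
Definition sterm (phi : formula) (t : att) : Prop :=
  exists (u : V + D) (h : int), [/\ in_symb phi u, in_window phi h & t = xterm u h].

(* Temporal terms are fresh variables: an assignment gives them unrelated values
   and is only required to fix the constants. *)
Definition assignment (v : att -> D) : Prop := forall c : D, v (Cst c) = c.

Definition atom_sat (v : att -> D) (a : atom) : Prop :=
  let: Atom _ R ts := a in csint R (map_tuple v ts).

Definition constraints_over (phi : formula) (S : atom -> Prop) : Prop :=
  forall (n : nat) (R : csrel CS n) (ts : n.-tuple att),
    S (Atom R ts) -> forall j : 'I_n, sterm phi (tnth ts j).

Definition consistent (S : atom -> Prop) : Prop :=
  exists2 v : att -> D, assignment v & forall a : atom, S a -> atom_sat v a.

Record symval (phi : formula) : Type := SymVal {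
  constrs :> atom -> Prop;
  constrs_over : constraints_over phi constrs;
  constrs_consistent : consistent constrs;
  constrs_maximal : forall S : atom -> Prop,
    constraints_over phi S -> consistent S ->
    (forall a : atom, constrs a -> S a) -> (forall a : atom, S a -> constrs a)
}.

Inductive constraint : Type :=
  | CAtom of atom
  | CNot of constraint
  | COr of constraint & constraint.

Fixpoint csat (v : att -> D) (xi : constraint) : Prop :=
  match xi with
  | CAtom a => atom_sat v a
  | CNot x => ~ csat v x
  | COr x y => csat v x \/ csat v y
  end.

Definition sym_sat (phi : formula) (sv : symval phi) (xi : constraint) : Prop :=
  forall v : att -> D, assignment v -> (forall a : atom, sv a -> atom_sat v a) -> csat v xi.

Definition lt_atom (s t : att) : atom := Atom (cslt CS) [tuple s; t].
Definition eq_atom (s t : att) : atom := Atom (cseq CS) [tuple s; t].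

Definition c_gt (s t : att) : constraint := CAtom (lt_atom t s).
Definition c_ge (s t : att) : constraint := COr (c_gt s t) (CAtom (eq_atom t s)).

(* Consecutive symbolic valuations agree on the terms they share: a constraint of
   rho(i) over shifts that are all above the least one holds in rho(i+1) with every
   shift decreased by one. *)
Definition locally_consistent (phi : formula) (rho : nat -> symval phi) : Prop :=
  forall (i n : nat) (R : csrel CS n) (args : n.-tuple ((V + D) * int)),
    (forall j : 'I_n, [/\ in_symb phi (tnth args j).1, in_window phi (tnth args j).2
                        & in_window phi ((tnth args j).2 - 1)]) ->
    rho i (Atom R (map_tuple (fun w => xterm w.1 w.2) args)) ->
    rho i.+1 (Atom R (map_tuple (fun w => xterm w.1 (w.2 - 1)) args)).

Record vertex (phi : formula) : Type := Vertex {
  vvar : V + D;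
  vpos : int;
  vvarP : in_symb phi vvar
}.

Inductive label : Type := Llt | Leq.

Definition label_atom (lab : label) : att -> att -> atom :=
  match lab with Llt => lt_atom | Leq => eq_atom end.

Definition edge (phi : formula) (rho : nat -> symval phi) (lab : label)
    (u w : vertex phi) : Prop :=
  exists l : nat,
    [/\ in_window phi (vpos u - l%:Z), in_window phi (vpos w - l%:Z)
      & rho l (label_atom lab (xterm (vvar u) (vpos u - l%:Z))
                              (xterm (vvar w) (vpos w - l%:Z)))].

Definition backward_path (phi : formula) (rho : nat -> symval phi)
    (d : nat -> vertex phi) : Prop :=
  forall i : nat, (exists lab : label, edge rho lab (d i.+1) (d i)) /\
                  (vpos (d i) <= vpos (d i.+1))%R.

Definition strict_backward (phi : formula) (rho : nat -> symval phi)
    (d : nat -> vertex phi) : Prop :=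
  forall n : nat, exists2 i : nat, (n <= i)%N & edge rho Llt (d i.+1) (d i).

(* The positions never become stationary.  Every vertex has a self-loop labelled
   by equality, so a sequence repeating one vertex would otherwise be an infinite
   path.  Along a strict path in a locally consistent word this is automatic. *)
Definition progressing (phi : formula) (d : nat -> vertex phi) : Prop :=
  forall n : nat, exists2 m : nat, (n < m)%N & (vpos (d n) < vpos (d m))%R.

Record point (phi : formula) : Type := Point {
  pvar : V + D;
  psv : nat;
  pshift : int;
  pvarP : in_symb phi pvar;
  pshiftP : in_window phi pshift
}.

Definition ppos (phi : formula) (p : point phi) : int := (psv p)%:Z + pshift p.

Definition point_rel (phi : formula) (rho : nat -> symval phi)
    (op : att -> att -> constraint) (p1 p2 : point phi) : Prop :=
  [/\ (ppos p2 - ppos p1 < flambda phi)%R,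
      (ppos p1 <= ppos p2)%R
    & exists l : nat,
        [/\ in_window phi (ppos p1 - l%:Z), in_window phi (ppos p2 - l%:Z)
          & sym_sat (rho l) (op (xterm (pvar p1) (ppos p1 - l%:Z))
                                (xterm (pvar p2) (ppos p2 - l%:Z)))]].

Definition point_ge (phi : formula) (rho : nat -> symval phi) := point_rel rho c_ge.
Definition point_gt (phi : formula) (rho : nat -> symval phi) := point_rel rho c_gt.

Definition chain_ge (phi : formula) (rho : nat -> symval phi) : point phi -> point phi -> Prop :=
  Relation_Operators.clos_trans (point phi) (point_ge rho).

Definition chain_gt (phi : formula) (rho : nat -> symval phi) (p1 p2 : point phi) : Prop :=
  exists p' p'' : point phi,
    [/\ chain_ge rho p1 p', point_gt rho p' p'' & chain_ge rho p'' p2].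

(* equivalence of points modulo the period P *)
Definition point_equiv (phi : formula) (P : nat) (p p' : point phi) : Prop :=
  [/\ pvar p = pvar p', pshift p = pshift p'
    & exists i : int, (psv p')%:Z = (psv p)%:Z + i * P%:Z].

End Syntax.

(* The word alpha beta^omega, for beta nonempty; the default [x0] is then unused. *)
Definition lasso (T : Type) (x0 : T) (alpha beta : seq T) (i : nat) : T :=
  if (i < size alpha)%N then nth x0 alpha i
  else nth x0 beta ((i - size alpha) %% size beta)%N.

(* Main.v *)
(* Along a descending chain both the position grows and the value decreases.  An
   infinite backward path meets the window of every occurrence of [s] in the
   periodic part; comparing in [s] the terms at which it leaves these windows,
   finiteness yields two consecutive ones whose values do not decrease.  The chain
   between them can then be redirected, where it crosses the translate by |beta| of
   its starting vertex, to end at that translate. Conversely such a chain is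
   repeated forever.  Local consistency makes comparisons independent of the
   window in which they are made. *)

Require Import Defs.
From mathcomp Require Import all_boot all_order all_algebra.
From mathcomp Require Import boolp zify.

Set Implicit Arguments.
Unset Strict Implicit.
Unset Printing Implicit Defensive.

Import Order.TTheory GRing.Theory Num.Theory.

(** * Sequences with values in a finite part of a linear order *)

Section FiniteDescent.

Variables (disp : Order.disp_t) (D : orderType disp).

(** Each strict descent lowers the number of elements of [S] below the current value. *)
Lemma no_finite_descent (S : seq D) (F : nat -> D) :
  (forall t, F t \in S) -> (forall t, F t.+1 <= F t)%O ->
  (forall n, exists2 t, n <= t & (F t.+1 < F t)%O) -> False.
Proof.
move=> FS Fle Flt; pose rank t := count (fun x => x < F t)%O S.
have Fmono n m : n <= m -> (F m <= F n)%O.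
  elim: m => [|m IHm]; first by rewrite leqn0 => /eqP->.
  by rewrite leq_eqVlt => /predU1P[->//|/IHm]; apply/le_trans.
suff noF m n : rank n < m -> False by exact: (noF (rank 0).+1 0).
elim: m n => // m IHm n; rewrite ltnS => rkn.
have [t nt Ft] := Flt n; apply: (IHm t.+1); apply: leq_trans rkn.
have ltS x : (x < F t.+1)%O ==> ((x < F n)%O && (x != F t.+1)).
  apply/implyP => xt; rewrite (lt_eqF xt) andbT.
  exact: lt_le_trans xt (Fmono _ _ (leqW nt)).
(* The value [F t.+1] lies in [S] and below [F n], so excluding it makes the count strictly
   smaller. *)
apply: (@leq_ltn_trans (count (fun x => (x < F n)%O && (x != F t.+1)) S)).
  by apply: sub_count => x; apply/implyP.
rewrite /rank -[ltnRHS]size_filter -(count_predC (predC1 (F t.+1))) !count_filter.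
rewrite -addn1 leq_add //; first by apply: sub_count => x /=; rewrite andbC.
rewrite -has_count; apply/hasP; exists (F t.+1); first exact: FS.
by rewrite /= eqxx /=; apply: lt_le_trans Ft (Fmono _ _ nt).
Qed.

(** Otherwise [F] would decrease weakly everywhere and strictly at the infinitely many indices
    satisfying [P]. *)
Lemma finite_nondecrease (S : seq D) (F : nat -> D) (P : nat -> Prop) :
  (forall t, F t \in S) -> (forall n, exists2 t, n <= t & P t) ->
  exists t, (F t < F t.+1)%O \/ (F t = F t.+1 /\ P t).
Proof.
move=> FS Pinf; apply/not_existsP => noF.
have Fle t : (F t.+1 <= F t)%O by rewrite leNgt; apply/negP => ?; apply: (noF t); left.
apply: (no_finite_descent FS Fle) => n; have [t nt Pt] := Pinf n; exists t => //.
rewrite lt_neqAle Fle andbT; apply/eqP => FE; apply: (noF t); right; split=> //.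
Qed.

End FiniteDescent.

Local Open Scope ring_scope.

(** * Symbolic valuations and their models *)

Section SymbolicValuations.

Variables (disp : Order.disp_t) (D : orderType disp) (CS : constraint_system D).
Variables (V : finType) (phi : formula CS V).
Implicit Type sv : symval phi.

Definition model (sv : symval phi) : att D V -> D := s2val (cid2 (constrs_consistent sv)).

Lemma model_assignment sv : assignment (model sv).
Proof. exact: s2valP (cid2 _). Qed.

Lemma model_sat sv a : sv a -> atom_sat (model sv) a.
Proof. exact: s2valP' (cid2 (constrs_consistent sv)) a. Qed.

(* By maximality, a symbolic valuation is the complete type of any of its models. *)
Lemma constrs_model sv n (R : csrel CS n) (ts : n.-tuple (att D V)) :
  (forall j, sterm phi (tnth ts j)) ->
  sv (Atom R ts) <-> csint R (map_tuple (model sv) ts).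
Proof.
move=> tsP; split=> [/model_sat//|tsR].
pose S (a : atom CS V) := let: Atom m Q us := a in
  (forall j, sterm phi (tnth us j)) /\ csint Q (map_tuple (model sv) us).
apply: (@constrs_maximal _ _ _ _ _ sv S) => //.
- by move=> m Q us [].
- by exists (model sv); [exact: model_assignment | case=> m Q us []].
- by case=> m Q us svQ; split; [exact: (constrs_over svQ) | exact: model_sat svQ].
Qed.

Lemma tnth2P (T : Type) (P : T -> Prop) (x y : T) :
  P x -> P y -> forall j, P (tnth [tuple x; y] j).
Proof. by move=> Px Py [[|[|//]] ?]. Qed.

Lemma map_tuple2 (S T : Type) (f : S -> T) (x y : S) :
  map_tuple f [tuple x; y] = [tuple f x; f y].
Proof. exact: val_inj. Qed.

Lemma lt_atomP sv t u : sterm phi t -> sterm phi u ->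
  sv (lt_atom CS t u) <-> (model sv t < model sv u)%O.
Proof.
move=> tP uP; rewrite -(csltP CS) -map_tuple2.
by apply: constrs_model; apply: tnth2P.
Qed.

Lemma eq_atomP sv t u : sterm phi t -> sterm phi u ->
  sv (eq_atom CS t u) <-> model sv t = model sv u.
Proof.
move=> tP uP; rewrite -(cseqP CS) -map_tuple2.
by apply: constrs_model; apply: tnth2P.
Qed.

(** One model decides entailment, because a comparison true in it is itself a constraint of [sv]. *)
Lemma sym_sat_gtP sv t u : sterm phi t -> sterm phi u ->
  sym_sat sv (c_gt CS t u) <-> (model sv u < model sv t)%O.
Proof.
move=> tP uP; split=> [/(_ _ (model_assignment sv) (@model_sat sv)) /=|tu v _ svv /=].
  by rewrite map_tuple2 csltP.
by apply: (svv (lt_atom CS u t)); apply/lt_atomP.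
Qed.

Lemma sym_sat_geP sv t u : sterm phi t -> sterm phi u ->
  sym_sat sv (c_ge CS t u) <-> (model sv u <= model sv t)%O.
Proof.
move=> tP uP; split=> [/(_ _ (model_assignment sv) (@model_sat sv)) /=|].
  by rewrite !map_tuple2 csltP cseqP => -[/ltW//|->].
rewrite le_eqVlt => /predU1P[ut|ut] v _ svv /=.
  by right; apply: (svv (eq_atom CS u t)); apply/eq_atomP.
by left; apply: (svv (lt_atom CS u t)); apply/lt_atomP.
Qed.

Lemma in_symb_finite : exists L : seq (V + D), forall u, in_symb phi u -> u \in L.
Proof.
suff [L LP] : exists L : seq D, forall c, in_const phi c -> c \in L.
  exists ([seq inl x | x <- enum V] ++ [seq inr c | c <- L]) => -[x _|c /LP cL];
    rewrite mem_cat; apply/orP; [left | right]; apply: map_f => //.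
  by rewrite mem_enum.
(* Values between two occurring constants count only for a discrete order, and then each such
   interval is finite. *)
have [Ddisc|Ddisc] := EM (discrete_order D); last first.
  by exists (occ_consts phi) => c [//|[]].
have [g gP] := choice (fun ab => Ddisc ab.1 ab.2).
pose occ := occ_consts phi; exists (occ ++ flatten [seq g (a, b) | a <- occ, b <- occ]).
move=> c; rewrite mem_cat => -[->//|[_ [a [b [aP bP ac cb]]]]]; apply/orP; right.
apply/flattenP; exists (g (a, b)); last exact: gP.
by apply/allpairsP; exists (a, b).
Qed.

End SymbolicValuations.

(** * Values of vertices, descents and runs *)

Section Words.

Variables (disp : Order.disp_t) (D : orderType disp) (CS : constraint_system D).
Variables (V : finType) (phi : formula CS V) (rho : nat -> symval phi).
Hypothesis rho_lc : locally_consistent rho.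
Implicit Types (u v w x y : vertex phi) (c : bool).

Definition visible (l : nat) u : Prop := in_window phi (vpos u - l%:Z).

Definition vterm (l : nat) u : att D V := xterm (vvar u) (vpos u - l%:Z).

(** Each letter has its own chosen model, so values from different windows may differ; only their
    order will be transferred. *)
Definition value (l : nat) u : D := model (rho l) (vterm l u).

Lemma vterm_sterm l u : visible l u -> sterm phi (vterm l u).
Proof. by move=> lu; exists (vvar u), (vpos u - l%:Z); split=> //; exact: vvarP. Qed.

Lemma visible_between l u v w :
  vpos u <= vpos v -> vpos v <= vpos w -> visible l u -> visible l w -> visible l v.
Proof. rewrite /visible /in_window; lia. Qed.

Lemma shift_constraint l u w (R : csrel CS 2) :
  visible l u -> visible l w -> visible l.+1 u -> visible l.+1 w ->
  rho l (Atom R [tuple vterm l u; vterm l w]) ->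
  rho l.+1 (Atom R [tuple vterm l.+1 u; vterm l.+1 w]).
Proof.
have posS x : vpos x - l%:Z - 1 = vpos x - l.+1%:Z by lia.
move=> lu lw Su Sw ruw.
have := rho_lc (n := 2) (R := R)
  (args := [tuple (vvar u, vpos u - l%:Z); (vvar w, vpos w - l%:Z)]).
rewrite !map_tuple2 /= !posS; apply; last exact: ruw.
apply: (tnth2P (P := fun a => [/\ in_symb phi a.1, in_window phi a.2
                               & in_window phi (a.2 - 1)]));
  by rewrite /= posS; split=> //; exact: vvarP.
Qed.

(** Local consistency only moves constraints forward; trichotomy supplies the converse. *)
Lemma value_lt_succ l u w :
  visible l u -> visible l w -> visible l.+1 u -> visible l.+1 w ->
  (value l.+1 u < value l.+1 w)%O = (value l u < value l w)%O.
Proof.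
have step x y : visible l x -> visible l y -> visible l.+1 x -> visible l.+1 y ->
    (value l x < value l y)%O -> (value l.+1 x < value l.+1 y)%O.
  move=> lx ly Sx Sy /lt_atomP xy; apply/lt_atomP; try exact: vterm_sterm.
  by apply: shift_constraint => //; apply: xy; exact: vterm_sterm.
have stepE x y : visible l x -> visible l y -> visible l.+1 x -> visible l.+1 y ->
    value l x = value l y -> value l.+1 x = value l.+1 y.
  move=> lx ly Sx Sy /eq_atomP xy; apply/eq_atomP; try exact: vterm_sterm.
  by apply: shift_constraint => //; apply: xy; exact: vterm_sterm.
move=> lu lw Su Sw; case: (ltgtP (value l u) (value l w)) => [uw|wu|uw].
- exact: step.
- by apply/negbTE; rewrite -leNgt ltW // step.
- by rewrite (stepE u w) // ltxx.
Qed.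

Lemma value_lteif c l m u w :
  visible l u -> visible l w -> visible m u -> visible m w ->
  (value m u < value m w ?<= if c)%O = (value l u < value l w ?<= if c)%O.
Proof.
suff valueE x y : visible l x -> visible l y -> visible m x -> visible m y ->
    (value m x < value m y)%O = (value l x < value l y)%O.
  by case: c => lu lw mu mw /=; [rewrite !leNgt|]; rewrite valueE.
wlog lm : l m / (l <= m)%N => [IH lx ly mx my|].
  by case/orP: (leq_total l m) => ?; [|symmetry]; apply: IH.
move/subnKC: lm => <-; elim: (m - l)%N => [|n IHn] lx ly mx my; first by rewrite addn0.
(* The windows that see a given vertex form an interval, so the induction never loses sight of
   it. *)
have nx : visible (l + n) x by move: lx mx; rewrite /visible /in_window; lia.
have ny : visible (l + n) y by move: ly my; rewrite /visible /in_window; lia.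
by move: mx my; rewrite addnS => mx my; rewrite value_lt_succ // IHn.
Qed.

(* The flag [c] is [true] for a weak descent and [false] for a strict one. *)
Definition descends c u w : Prop :=
  vpos u <= vpos w /\
  exists l, [/\ visible l u, visible l w & (value l w < value l u ?<= if c)%O].

(** Flags combine by conjunction, so one strict step makes the whole run strict; both kinds of chain
    are thus treated at once. *)
Inductive run : bool -> vertex phi -> vertex phi -> Prop :=
| run_step c u w of descends c u w : run c u w
| run_cat c c' u v w of run c u v & run c' v w : run (c && c') u w.

Lemma descendsW c u w : descends c u w -> descends true u w.
Proof.
by move=> [uw [l [lu lw wu]]]; split=> //; exists l; split=> //; exact: lteifW wu.
Qed.

Lemma runW c u w : run c u w -> run true u w.
Proof.
elim=> [{}c {}u {}w /descendsW|{}c c' {}u v {}w _ uv _ vw]; first exact: run_step.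
exact: run_cat uv vw.
Qed.

Lemma run_pos c u w : run c u w -> vpos u <= vpos w.
Proof. by elim=> [? ? ? []|? ? ? ? ? _ uv _ vw] //; exact: le_trans uv vw. Qed.

Lemma run_visible c u w : run c u w -> exists l, visible l w.
Proof. by elim=> [? ? ? [_ [l [_ ? _]]]|//]; exists l. Qed.

(** Positions grow along a run, so a window seeing both ends sees every intermediate vertex, and
    transitivity applies inside it. *)
Lemma run_value c l u w : run c u w -> visible l u -> visible l w ->
  (value l w < value l u ?<= if c)%O.
Proof.
elim=> [{}c {}u {}w [_ [m [mu mw wu]]] lu lw|{}c c' {}u v {}w uv IHu vw IHw lu lw].
  by rewrite (value_lteif c mw mu).
have lv := visible_between (run_pos uv) (run_pos vw) lu lw.
by rewrite andbC; apply: lteif_trans (IHw lv lw) (IHu lu lv).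
Qed.

(* Cutting a run where it crosses the position of [y]: there some edge spans [y],
   so its source dominates [y] in the window of that edge. *)
Lemma run_cross c c' l u w y : run c u w -> visible l w -> visible l y ->
  (value l y < value l w ?<= if c')%O -> vpos u <= vpos y -> run (c && c') u y.
Proof.
move=> uw; elim: uw c' => [{}c {}u {}w uw|{}c c2 {}u v {}w uv IHu vw IHw] c' lw ly yw uy.
  have [wy|/ltW yw'] := leP (vpos w) (vpos y).
    by apply: run_cat (run_step uw) (run_step _); split=> //; exists l.
  have [_ [m [mu mw wu]]] := uw.
  have my := visible_between uy yw' mu mw.
  apply: run_step; split=> //; exists m; split=> //.
  by rewrite andbC; apply: lteif_trans wu; rewrite (value_lteif _ ly lw).
have [vy|/ltW yv] := leP (vpos v) (vpos y).
  by rewrite -andbA; apply: run_cat uv (IHw _ _ _ _ _).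
(* The crossing is in the first half. The discarded second half leaves its flag [c2] in the
   comparison of [y] with [v]. *)
have lv := visible_between yv (run_pos vw) ly lw.
rewrite -andbA [c2 && c']andbC; apply: IHu => //.
exact: lteif_trans yw (run_value vw lv lw).
Qed.

(** * Translation between equal suffixes of the word *)

Definition shift (z : int) u : vertex phi := Vertex (vpos u + z) (vvarP u).

(** Equal letters share the same chosen model, so here the values themselves agree, not merely their
    order. *)
Lemma value_shift (m n l : nat) u :
  rho (m + l) = rho (n + l) -> value (m + l) u = value (n + l) (shift (n%:Z - m%:Z) u).
Proof.
move=> rhoE; rewrite /value rhoE /vterm /=; congr (model _ (xterm _ _)); lia.
Qed.

Lemma descends_shift c (m n : nat) u w :
  (forall l, rho (m + l) = rho (n + l)) -> m%:Z + ffloor phi <= vpos u ->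
  descends c u w -> descends c (shift (n%:Z - m%:Z) u) (shift (n%:Z - m%:Z) w).
Proof.
move=> rhoE mu [uw [l [lu lw wu]]]; split; first by rewrite /=; lia.
(* Subtraction is truncated, so [m + (l - m)] is the maximum of [l] and [m]: a window before [m] is
   replaced by that of [m], where the bound [mu] keeps both vertices. *)
have [lu' lw'] : visible (m + (l - m)) u /\ visible (m + (l - m)) w.
  by move: lu lw; rewrite /visible /in_window; split; lia.
exists (n + (l - m))%N; split.
- by move: lu'; rewrite /visible /in_window /=; lia.
- by move: lw'; rewrite /visible /in_window /=; lia.
- by rewrite -!value_shift // (value_lteif c lw lu).
Qed.

Lemma run_shift c (m n : nat) u w :
  (forall l, rho (m + l) = rho (n + l)) -> m%:Z + ffloor phi <= vpos u ->
  run c u w -> run c (shift (n%:Z - m%:Z) u) (shift (n%:Z - m%:Z) w).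
Proof.
move=> rhoE + uw; elim: uw => [{}c {}u {}w uw mu|{}c c' {}u v {}w uv IHu vw IHw mu].
  exact/run_step/descends_shift.
by apply: run_cat (IHu mu) (IHw _); exact: le_trans mu (run_pos uv).
Qed.

Lemma shift_shift (y z : int) u : shift y (shift z u) = shift (z + y) u.
Proof. by rewrite /shift /= addrA. Qed.

Lemma visible_shift (m n : nat) u : visible m u -> visible n (shift (n%:Z - m%:Z) u).
Proof. rewrite /visible /in_window /=; lia. Qed.

Lemma run_refl l u : visible l u -> run true u u.
Proof. by move=> lu; apply: run_step; split=> //; exists l; rewrite lteifxx. Qed.

Lemma finite_window_values l : exists S : seq D, forall u, visible l u -> value l u \in S.
Proof.
have [L LP] := in_symb_finite phi.
exists [seq model (rho l) (xterm x (ffloor phi + i%:Z)) | x : V + D <- L,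
          i <- iota 0 (absz (flambda phi)%R)] => u lu.
apply/allpairsP; exists (vvar u, absz (vpos u - l%:Z - ffloor phi)%R).
split; first exact/LP/vvarP.
  by rewrite mem_iota /=; move: lu; rewrite /visible /in_window /flambda; lia.
rewrite /value /vterm /=; congr (model _ (xterm _ _)).
by move: lu; rewrite /visible /in_window; lia.
Qed.

(** * Dictionary between descents, edges and points *)

Lemma descends_edge u w :
  descends true u w <-> (exists lab, edge rho lab w u) /\ vpos u <= vpos w.
Proof.
split=> [[uw [l [lu lw]]]|[[lab [l [lw lu uw]]] pos_uw]].
  (* Edges lead from the smaller to the larger value, hence against the descent. *)
  rewrite lteifT le_eqVlt => /predU1P[E|E]; split=> //.
    by exists Leq, l; split=> //=; apply/eq_atomP => //; apply: vterm_sterm.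
  by exists Llt, l; split=> //=; apply/lt_atomP => //; apply: vterm_sterm.
split=> //; exists l; split=> //; case: lab uw => [/lt_atomP|/eq_atomP] E.
  by apply: ltW; apply: E; exact: vterm_sterm.
by rewrite lteifT le_eqVlt; apply/orP; left; apply/eqP; apply: E; exact: vterm_sterm.
Qed.

Lemma descends_edge_lt u w :
  descends false u w <-> edge rho Llt w u /\ vpos u <= vpos w.
Proof.
split=> [[uw [l [lu lw wu]]]|[[l [lw lu wu]] uw]]; split=> //; exists l; split=> //.
  by apply/lt_atomP => //; exact: vterm_sterm.
by apply/lt_atomP; [exact: vterm_sterm | exact: vterm_sterm | exact: wu].
Qed.

(** Forgets how the position splits into [psv] and [pshift]; the relations on points depend only on
    this vertex. *)
Definition pvertex (p : point phi) : vertex phi := Vertex (ppos p) (pvarP p).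

Definition point_at l u (lu : visible l u) : point phi := Point l (vvarP u) lu.

Lemma point_atK l u (lu : visible l u) : pvertex (point_at lu) = u.
Proof. by case: u lu => x z xP lu; rewrite /pvertex /ppos /= addrC subrK. Qed.

Lemma pvertex_visible p : visible (psv p) (pvertex p).
Proof. by rewrite /visible /= /ppos addrC addKr; exact: pshiftP. Qed.

Lemma point_relP c (op : att D V -> att D V -> constraint CS V) p p' :
  (forall sv t t', sterm phi t -> sterm phi t' ->
     sym_sat sv (op t t') <-> (model (phi := phi) sv t' < model sv t ?<= if c)%O) ->
  point_rel rho op p p' <-> descends c (pvertex p) (pvertex p').
Proof.
move=> opP.
have termP q l : visible l (pvertex q) -> sterm phi (xterm (pvar q) (ppos q - l%:Z)).
  exact: vterm_sterm.
split=> [[_ pp' [l [lp lp' E]]]|[pp' [l [lp lp' E]]]].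
  by split=> //; exists l; split=> //; apply/(opP _ _ _ (termP _ _ lp) (termP _ _ lp')).
split=> //.
  (* A window has [flambda phi] positions, so sharing one bounds the distance. *)
  by move: lp lp'; rewrite /visible /in_window /flambda /=; lia.
by exists l; split=> //; apply/(opP _ _ _ (termP _ _ lp) (termP _ _ lp')).
Qed.

Lemma point_geP p p' : point_ge rho p p' <-> descends true (pvertex p) (pvertex p').
Proof. by apply: point_relP => sv t t'; exact: sym_sat_geP. Qed.

Lemma point_gtP p p' : point_gt rho p p' <-> descends false (pvertex p) (pvertex p').
Proof. by apply: point_relP => sv t t'; exact: sym_sat_gtP. Qed.

Lemma chain_ge_run p p' : chain_ge rho p p' -> run true (pvertex p) (pvertex p').
Proof.
by elim=> [q q' /point_geP/run_step|q r q' _ qr _ /(run_cat qr)].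
Qed.

Lemma chain_gt_run p p' : chain_gt rho p p' -> run false (pvertex p) (pvertex p').
Proof.
move=> [q [q' [/chain_ge_run pq /point_gtP/run_step qq' /chain_ge_run qp']]].
exact: run_cat (run_cat pq qq') qp'.
Qed.

Lemma chain_ge_trans p q r : chain_ge rho p q -> chain_ge rho q r -> chain_ge rho p r.
Proof. exact: Relation_Operators.t_trans. Qed.

(** Though only a transitive closure is taken, equality gives loops; they pad a lone strict step
    into a [chain_gt]. *)
Lemma chain_ge_refl p : chain_ge rho p p.
Proof.
apply/Relation_Operators.t_step/point_geP; split=> //.
by exists (psv p); rewrite lteifxx; split=> //; exact: pvertex_visible.
Qed.

Lemma chain_gtW p p' : chain_gt rho p p' -> chain_ge rho p p'.
Proof.
move=> [q [q' [pq /point_gtP/descendsW/point_geP qq' qp']]].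
exact: chain_ge_trans pq (chain_ge_trans (Relation_Operators.t_step _ _ _ _ qq') qp').
Qed.

Lemma run_chain c u w : run c u w -> forall p p', pvertex p = u -> pvertex p' = w ->
  if c then chain_ge rho p p' else chain_gt rho p p'.
Proof.
elim=> [{}c {}u {}w uw p p' pu pw|{}c c' {}u v {}w uv IHu vw IHw p p' pu pw].
  rewrite -pu -pw in uw; case: c uw => [/point_geP|/point_gtP] pp'.
    exact: Relation_Operators.t_step.
  by exists p, p'; split=> //; exact: chain_ge_refl.
(* The middle vertex is visible somewhere, hence carried by a point. *)
have [l lv] := run_visible uv.
have := IHu p _ pu (point_atK lv); have := IHw _ p' (point_atK lv) pw.
case: c c' {uv vw IHu IHw} => -[] /= qp' pq.
- exact: chain_ge_trans pq qp'.
- have [q [q' [pq' qq' q'p]]] := qp'.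
  by exists q, q'; split=> //; exact: chain_ge_trans pq pq'.
- have [q [q' [pq' qq' q'p]]] := pq.
  by exists q, q'; split=> //; exact: chain_ge_trans q'p qp'.
- have [q [q' [pq' qq' q'p]]] := pq.
  by exists q, q'; split=> //; exact: chain_ge_trans q'p (chain_gtW qp').
Qed.

(** Flattens nested concatenations into an indexed sequence, the form needed to repeat a run
    periodically. *)
Lemma run_path c u w : run c u w -> exists n (q : nat -> vertex phi),
  [/\ (0 < n)%N, q 0 = u, q n = w, forall i, (i < n)%N -> descends true (q i) (q i.+1)
    & c = false -> exists2 i, (i < n)%N & descends false (q i) (q i.+1)].
Proof.
elim=> [{}c {}u {}w uw|{}c c' {}u v {}w _ [n [q [n0 q0 qn qS qs]]] _
  [m [r [m0 r0 rm rS rs]]]].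
  exists 1%N, (fun i => if i is 0 then u else w); split=> //.
    by case=> // _; exact: descendsW uw.
  by move=> c0; exists 0%N => //; rewrite -c0.
pose h i := if (i < n)%N then q i else r (i - n)%N.
have hq i : (i <= n)%N -> h i = q i.
  rewrite leq_eqVlt /h => /predU1P[->|->//].
  by rewrite ltnn subnn r0 qn.
have hr i : h (n + i)%N = r i by rewrite /h ltnNge leq_addr addKn.
exists (n + m)%N, h; split; rewrite ?(hq 0%N) ?hr ?addn_gt0 ?n0 //.
  move=> i inm; have [ni|ni] := ltnP i n; first by rewrite !hq ?(ltnW ni) //; exact: qS.
  by rewrite -(subnKC ni) -addnS !hr; apply: rS; lia.
case: c c' qs rs => -[] // qs rs _; first 1 last.
- have [i ni E] := qs erefl; exists i; first by lia.
  by rewrite !hq ?(ltnW ni).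
- have [i ni E] := qs erefl; exists i; first by lia.
  by rewrite !hq ?(ltnW ni).
have [i mi E] := rs erefl; exists (n + i)%N; first by lia.
by rewrite -addnS !hr.
Qed.

(** * Infinite backward paths *)

Lemma backward_path_mono (d : nat -> vertex phi) i j :
  backward_path rho d -> (i <= j)%N -> vpos (d i) <= vpos (d j).
Proof.
move=> dP; elim: j => [|j IHj]; first by rewrite leqn0 => /eqP->.
rewrite leq_eqVlt => /predU1P[->//|/IHj ij].
exact: le_trans ij (dP j).2.
Qed.

Lemma backward_path_visible (d : nat -> vertex phi) i :
  backward_path rho d -> exists l, visible l (d i).
Proof. by move=> /(_ i) /descends_edge[_ [l [? _ _]]]; exists l. Qed.

Lemma backward_path_run (d : nat -> vertex phi) i j :
  backward_path rho d -> (i <= j)%N -> run true (d i) (d j).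
Proof.
move=> dP; elim: j => [|j IHj].
  by rewrite leqn0 => /eqP->; have [l] := backward_path_visible 0 dP; exact: run_refl.
rewrite leq_eqVlt => /predU1P[->|/IHj ij].
  by have [l] := backward_path_visible j.+1 dP; exact: run_refl.
by apply: (run_cat ij); apply: run_step; apply/descends_edge/dP.
Qed.

(* At a stationary position all vertices would lie in one window, where only
   finitely many values are available for infinitely many strict descents. *)
Lemma strict_progressing (d : nat -> vertex phi) :
  backward_path rho d -> strict_backward rho d -> progressing d.
Proof.
move=> dP ds n; apply: contrapT => stuck.
have posE i : vpos (d (n + i)%N) = vpos (d n).
  apply/eqP; rewrite eq_le (backward_path_mono dP (leq_addr _ _)) andbT leNgt.
  apply/negP => lt; apply: stuck; exists (n + i)%N => //.
  by rewrite -{1}[n]addn0 ltn_add2l lt0n; apply: contraTneq lt => ->; rewrite addn0 ltxx.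
have [l ln] := backward_path_visible n dP.
have li i : visible l (d (n + i)%N) by rewrite /visible posE.
have [S SP] := finite_window_values l.
apply: (@no_finite_descent _ _ S (fun i => value l (d (n + i)%N))).
- by move=> t; exact: SP.
- move=> t; apply: (run_value (c := true)); [|exact: li|exact: li].
  by apply: backward_path_run; rewrite // addnS.
move=> m; have [i mi E] := ds (n + m)%N; exists (i - n)%N; first by lia.
have ni : (n <= i)%N by lia.
apply: (run_value (c := false)); [|exact: li|exact: li].
rewrite addnS subnKC //; apply/run_step/descends_edge_lt; split=> //; exact: (dP i).2.
Qed.

Lemma progressing_unbounded (d : nat -> vertex phi) (z : int) :
  progressing d -> exists i, z < vpos (d i).
Proof.
move=> dp; pose k := (absz (z - vpos (d 0%N))%R).+1.
suff [i iz] : exists i, vpos (d 0%N) + k%:Z <= vpos (d i).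
  by exists i; lia.
elim: k => [|n [i ni]]; first by exists 0%N; rewrite addr0.
by have [j _ ij] := dp i; exists j; lia.
Qed.

Lemma crossing_index (d : nat -> vertex phi) (z : int) :
  progressing d -> vpos (d 0%N) <= z ->
  exists i, vpos (d i) <= z /\ z < vpos (d i.+1).
Proof.
move=> dp d0; have ex := progressing_unbounded z dp.
(* The predecessor of the first index beyond [z]; that index is nonzero because the path starts at
   or before [z]. *)
case: (ex_minnP ex) => -[|i] iz imin; first by move: d0; rewrite leNgt iz.
exists i; split=> //; rewrite leNgt; apply/negP => /imin; lia.
Qed.

(** * Words of period [b] from position [a] on *)

Section Periodic.

Variables a b : nat.
Hypothesis b_gt0 : (0 < b)%N.
Hypothesis rho_periodic : forall t l, rho (a + l)%N = rho (a + t * b + l)%N.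

Lemma periodic_backward_path c u : a%:Z + ffloor phi <= vpos u ->
  run c u (shift b u) -> exists d : nat -> vertex phi,
  [/\ backward_path rho d, progressing d & c = false -> strict_backward rho d].
Proof.
move=> au /run_path[n [q [n0 q0 qn qS qs]]].
(* Block number [i %/ n] is the translate of [q] by that many periods. *)
pose d i := shift (i %/ n * b)%N (q (i %% n)%N).
(* The case [i = n] glues consecutive blocks, since [q n] is [q 0] moved by one period. *)
have dE t i : (i <= n)%N -> d (t * n + i)%N = shift (t * b)%N (q i).
  rewrite leq_eqVlt /d => /predU1P[->|ni].
    rewrite -mulSnr modnMl mulnK // q0 qn shift_shift; congr shift; lia.
  by rewrite divnMDl // modnMDl divn_small // modn_small // addn0.
have qa i : (i <= n)%N -> a%:Z + ffloor phi <= vpos (q i).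
  elim: i => [|i IHi] ni; first by rewrite q0.
  by apply: le_trans (IHi (ltnW ni)) _; have [] := qS _ ni.
have dS c' t i : (i < n)%N -> descends c' (q i) (q i.+1) ->
    descends c' (d (t * n + i)%N) (d (t * n + i).+1).
  move=> ni E; rewrite -addnS !dE ?(ltnW ni) //.
  have := descends_shift (rho_periodic t) (qa _ (ltnW ni)) E.
  by rewrite PoszD addrAC subrr add0r.
have dP : backward_path rho d.
  move=> i; apply/descends_edge; rewrite (divn_eq i n).
  by apply: dS; rewrite ?ltn_mod //; apply: qS; rewrite ltn_mod.
exists d; split=> // [i|c0 i].
  exists ((i %/ n).+2 * n)%N; first by rewrite {1}(divn_eq i n); have := ltn_mod i n; lia.
  apply: (@le_lt_trans _ _ (vpos (d ((i %/ n).+1 * n)%N))).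
    apply: backward_path_mono => //; rewrite {1}(divn_eq i n).
    by have := ltn_mod i n; lia.
  by rewrite -[(_.+2 * n)%N]addn0 -[(_.+1 * n)%N]addn0 !dE //=; lia.
have [j nj E] := qs c0; exists (i * n + j)%N; first by nia.
by have /descends_edge_lt[] := dS _ i _ nj E.
Qed.

Lemma backward_path_periodic c (d : nat -> vertex phi) :
  backward_path rho d -> progressing d -> (c = false -> strict_backward rho d) ->
  exists2 u, visible a u & run c u (shift b u).
Proof.
(* Skipping [t0] periods puts the start of the path at or before the right end of every window
   [N t]. *)
move=> dP dp ds; pose t0 := absz (vpos (d 0%N) - fceil phi)%R.
pose N t := (a + (t0 + t) * b)%N.
have NS t : N t.+1 = (N t + b)%N by rewrite /N; lia.
have N0 t : vpos (d 0%N) <= (N t)%:Z + fceil phi by rewrite /N /t0; nia.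
have rhoN t l : rho (N t + l)%N = rho (a + l)%N by rewrite -rho_periodic.
have [idx idxP] := choice (fun t => crossing_index dp (N0 t)).
have idx_max t i : vpos (d i) <= (N t)%:Z + fceil phi -> (i <= idx t)%N.
  rewrite leqNgt; apply: contraTN => ii; rewrite -ltNge.
  exact: lt_le_trans (idxP t).2 (backward_path_mono dP ii).
have idx_mono r t : (r <= t)%N -> (idx r <= idx t)%N.
  by move=> rt; apply: idx_max; have := (idxP r).1; rewrite /N; nia.
(* The edge leaving this vertex ends beyond window [N t], so it lies in a later window, whose left
   end is further right; hence the vertex is still in window [N t]. *)
have idx_visible t : visible (N t) (d (idx t)).
  have [uw [l [lu lw _]]] := (descends_edge _ _).2 (dP (idx t)).
  by move: (idxP t) lu lw; rewrite /visible /in_window; lia.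
pose F t := value (N t) (d (idx t)).
(* Windows [N t] and [a] carry the same letter, so one finite list serves all [t]. *)
have [S SP] := finite_window_values a.
have FS t : F t \in S.
  rewrite /F -[N t]addn0 (value_shift (n := a)) ?rhoN //  addn0.
  exact/SP/visible_shift.
pose P t := c = false ->
  exists2 i, (idx t <= i < idx t.+1)%N & descends false (d i) (d i.+1).
have Pinf n : exists2 t, (n <= t)%N & P t.
  case: c ds @P => [_|/(_ erefl) ds] P; first by exists n.
  have [i ni E] := ds (idx n).
  have ex : exists t, (i < idx t)%N.
    by exists (absz (vpos (d i.+1) - fceil phi)%R); apply: idx_max; rewrite /N; nia.
  (* Minimality places the strict step [i] between the exits from two consecutive windows. *)
  case: (ex_minnP ex) => -[|t] it tmin.
    by have := leq_trans it (idx_mono _ _ (leq0n n)); rewrite ltnNge ni.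
  exists t.
    rewrite leqNgt; apply: contraL it => /idx_mono/leq_trans/(_ ni).
    by rewrite -leqNgt.
  move=> _; exists i; last by apply/descends_edge_lt; split=> //; exact: (dP i).2.
  by rewrite it andbT leqNgt; apply/negP => /tmin; rewrite ltnn.
have [t Ft] := finite_nondecrease FS Pinf.
set x := d (idx t) in Ft.
have xy : run c x (shift b x).
  have xv : visible (N t.+1) (shift b x).
    have := visible_shift (N t.+1) (idx_visible t).
    by rewrite NS PoszD addrAC subrr add0r.
  (* By periodicity [F t] is also the value of the translate of [x] in window [N t.+1], where it can
     be compared with [F t.+1]. *)
  have Fx : F t = value (N t.+1) (shift b x).
    rewrite /F -[N t]addn0 (value_shift (n := N t.+1)) ?rhoN // addn0.
    by rewrite NS PoszD addrAC subrr add0r.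
  have xle : vpos x <= vpos (shift b x) by rewrite /=; lia.
  have cross c1 c2 : run c1 x (d (idx t.+1)) ->
      (F t < F t.+1 ?<= if c2)%O -> run (c1 && c2) x (shift b x).
    by rewrite Fx => xd Fle; exact: run_cross xd (idx_visible t.+1) xv Fle xle.
  have seg := backward_path_run dP (idx_mono _ _ (leqnSn t)).
  (* Strictness comes either from the strict increase of [F] or from a strict step inside the
     segment. *)
  case: Ft => [/(cross true false seg)|[Ft Pt]]; first by case: (c) => // /runW.
  move: Pt; rewrite /P; case: (c) => [_|/(_ erefl)[i /andP[ti it] E]].
    by apply: (cross true true) seg _; rewrite Ft lteifxx.
  apply: (cross false true); last by rewrite Ft lteifxx.
  have descent := run_cat (backward_path_run dP ti) (run_step E).
  exact: run_cat descent (backward_path_run dP it).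
(* The run found near window [N t] is moved back to window [a]. *)
exists (shift (a%:Z - (N t)%:Z) x); first exact/visible_shift/idx_visible.
have := run_shift (n := a) (rhoN t) _ xy; rewrite !shift_shift [b%:Z + _]addrC; apply.
by move: (idx_visible t); rewrite -/x /visible /in_window; lia.
Qed.

Lemma periodic_points c :
  (exists2 u, visible a u & run c u (shift b u)) <->
  exists p p' : point phi, [/\ psv p = a, psv p' = (a + b)%N, point_equiv b p p'
    & if c then chain_ge rho p p' else chain_gt rho p p'].
Proof.
split=> [[u au ub]|[p [p' [pa p'ab [varE shE _] pp']]]].
  have bu : visible (a + b) (shift b u).
    by have := visible_shift (a + b) au; rewrite PoszD addrAC subrr add0r.
  exists (point_at au), (point_at bu); split=> //.
    by split=> //=; [lia | exists 1; lia].
  by apply: (run_chain ub); exact: point_atK.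
have p'E : pvertex p' = shift b (pvertex p).
  have posE : ppos p' = ppos p + b%:Z by rewrite /ppos pa p'ab shE; lia.
  rewrite /shift /pvertex /= posE; move: (pvarP p) (pvarP p'); rewrite varE => q q'.
  (* A vertex carries a proof about its symbol, so equating vertices needs proof irrelevance. *)
  by rewrite (Prop_irrelevance q q').
exists (pvertex p); first by rewrite -pa; exact: pvertex_visible.
by rewrite -p'E; case: c pp' => [/chain_ge_run|/chain_gt_run].
Qed.

Lemma backward_path_points c :
  (exists d, [/\ backward_path rho d, progressing d
                & c = false -> strict_backward rho d]) <->
  exists p p' : point phi, [/\ psv p = a, psv p' = (a + b)%N, point_equiv b p p'
    & if c then chain_ge rho p p' else chain_gt rho p p'].
Proof.
rewrite -periodic_points; split=> [[d [dP dp ds]]|[u au]].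
  exact: backward_path_periodic dP dp ds.
by apply: periodic_backward_path; move: au; rewrite /visible /in_window; lia.
Qed.

End Periodic.

End Words.

(** * Periodicity of the lasso word *)

Lemma lasso_rcons (T : Type) (s : T) (alpha beta : seq T) (l : nat) :
  lasso s (rcons alpha s) (rcons beta s) (size alpha + l) =
  nth s (rcons beta s) ((l + size beta) %% (size beta).+1).
Proof.
rewrite /lasso !size_rcons; case: l => [|l].
  by rewrite addn0 ltnSn nth_rcons ltnn eqxx add0n modn_small // nth_rcons ltnn eqxx.
by rewrite ltnNge addnS ltnS leq_addr /= subSS addKn addSnnS modnDr.
Qed.

(** Prefix and loop end with the same letter, so the period already begins at the last letter of the
    prefix. *)
Lemma lasso_periodic (T : Type) (s : T) (alpha beta : seq T) (t l : nat) :
  lasso s (rcons alpha s) (rcons beta s) (size alpha + l) =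
  lasso s (rcons alpha s) (rcons beta s) (size alpha + t * (size beta).+1 + l).
Proof. by rewrite -addnA !lasso_rcons -addnA modnMDl. Qed.

Theorem theorem5 (disp : Order.disp_t) (D : orderType disp) (CS : constraint_system D)
    (V : finType) (phi : formula CS V)
    (alpha beta alpha' beta' : seq (symval phi)) (s : symval phi)
    (rho : nat -> symval phi) (k : nat)
    (halpha : alpha = rcons alpha' s) (hbeta : beta = rcons beta' s)
    (hrho : forall i : nat, rho i = lasso s alpha beta i)
    (hk : k = (size (alpha ++ beta) - 1)%N)
    (hlc : locally_consistent rho) :
  ((exists d : nat -> vertex phi, backward_path rho d /\ progressing d) <->
   (exists p p' : point phi,
      [/\ psv p = size alpha', psv p' = k, point_equiv (size beta) p p'
        & chain_ge rho p p']))
  /\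
  ((exists d : nat -> vertex phi, backward_path rho d /\ strict_backward rho d) <->
   (exists p p' : point phi,
      [/\ psv p = size alpha', psv p' = k, point_equiv (size beta) p p'
        & chain_gt rho p p'])).
Proof.
have b0 : (0 < size beta)%N by rewrite hbeta size_rcons.
have periodic t l : rho (size alpha' + l)%N = rho (size alpha' + t * size beta + l)%N.
  by rewrite !hrho halpha hbeta size_rcons; exact: lasso_periodic.
(* The final [s] of [alpha] cancels the subtracted 1, so the two points are exactly one period
   apart. *)
have -> : k = (size alpha' + size beta)%N.
  by rewrite hk size_cat halpha size_rcons addSn subn1.
have points := backward_path_points hlc b0 periodic.
split; [rewrite -(points true) | rewrite -(points false)]; split.
- by move=> [d [dP dp]]; exists d.
- by move=> [d [dP dp _]]; exists d.
- move=> [d [dP ds]]; exists d; split=> [// | | _ //].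
  exact: (strict_progressing hlc dP ds).
- by move=> [d [dP _ ds]]; exists d; split=> //; exact: ds erefl.
Qed.
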